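(* Let $X$ be a triangulated manifold, let $k,l\ge 0$, let $\alpha\in C^k(X)$ and $\beta\in C^l(X)$ be real simplicial cochains, and let $\nu$ be an (oriented) $(k+l)$-dimensional simplex of $X$. Then $$\langle \alpha\wedge\beta,\nu\rangle=\int_\nu W\alpha\wedge W\beta,$$ where $\wedge$ on the left is the discrete wedge product of cochains (the antisymmetrized cup product), $\wedge$ on the right is the usual wedge product of differential forms on the simplex $\nu$, and $W$ is the Whitney map.
   Context: Chains and cochains: $C_k(X)$ is the real vector space of simplicial $k$-chains of $X$, generated by oriented $k$-simplices $[v_0,\ldots,v_k]$, with $[v_{\pi(0)},\ldots,v_{\pi(k)}]=\operatorname{sgn}(\pi)[v_0,\ldots,v_k]$. $C^k(X)$ is the dual space of $k$-cochains, and $\langle\alpha,c\rangle$ is the evaluation of $\alpha\in C^k(X)$ on $c\in C_k(X)$. Cup product: for $\alpha\in C^k(X)$, $\beta\in C^l(X)$ and any ordering $v_0,\ldots,v_{k+l}$ of the vertices of a $(k+l)$-simplex, the notation $\langle\alpha\smile\beta,[v_0,\ldots,v_{k+l}]\rangle$ means $\langle\alpha,[v_0,\ldots,v_k]\rangle\,\langle\beta,[v_k,\ldots,v_{k+l}]\rangle$ (this depends on the ordering of the vertices). Discrete wedge product: $\alpha\wedge\beta\in C^{k+l}(X)$ is defined on an oriented $(k+l)$-simplex $[v_0,\ldots,v_{k+l}]$ by $$\langle\alpha\wedge\beta,[v_0,\ldots,v_{k+l}]\rangle=\frac{1}{(k+l+1)!}\sum_{\tau\in S_{k+l+1}}\operatorname{sgn}(\tau)\,\langle\alpha\smile\beta,[v_{\tau(0)},\ldots,v_{\tau(k+l)}]\rangle,$$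 where $S_{k+l+1}$ is the group of permutations of $\{0,\ldots,k+l\}$, and is extended linearly to chains. Whitney map: $W$ is the linear map from $C^k(X)$ to piecewise polynomial (Whitney) $k$-forms on the underlying space of $X$. If, for an oriented $k$-simplex $\sigma=[v_0,\ldots,v_k]$, the cochain also denoted $\sigma$ takes the value $1$ on $\sigma$ and $0$ on every other $k$-simplex (up to orientation), then $$W\sigma=k!\sum_{i=0}^k(-1)^i\lambda_{v_i}\,d\lambda_{v_0}\wedge\cdots\wedge\widehat{d\lambda_{v_i}}\wedge\cdots\wedge d\lambda_{v_k},$$ where $\lambda_v$ is the piecewise linear barycentric coordinate function of the vertex $v$ (for $k=0$, $W\sigma=\lambda_{v_0}$). On a simplex $\nu$ the forms are those obtained by restricting to $\nu$. *)

(* Defs.v *)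
From HB Require Import structures.
From mathcomp Require Import all_boot all_order all_algebra finmap fingroup perm.
From mathcomp Require Import all_classical all_reals all_analysis.
From mathcomp Require freeg.

Set Implicit Arguments.
Unset Strict Implicit.
Unset Printing Implicit Defensive.
Import Order.TTheory GRing.Theory Num.Theory.
Import numFieldNormedType.Exports.
Local Open Scope classical_set_scope.
Local Open Scope ring_scope.

Record simplicial_complex (V : choiceType) := SimplicialComplex {
  is_simplex :> pred {fset V};
  is_simplex0 : ~~ is_simplex fset0;
  is_simplex_sub : forall s t : {fset V},
    is_simplex s -> (t `<=` s)%fset -> t != fset0 -> is_simplex t }.

Section OrderedSimplices.
Variables (V : choiceType) (X : simplicial_complex V).

(* A k-simplex of X together with a total order v_0, ..., v_k of its vertices. *)
Definition is_osimplex k (v : {ffun 'I_k.+1 -> V}) : bool :=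
  injectiveb v && X [fset v i | i : 'I_k.+1]%fset.

Record osimplex k := OSimplex {
  osvert :> {ffun 'I_k.+1 -> V};
  osimplexP : is_osimplex osvert }.

HB.instance Definition _ k := [isSub for @osvert k].
HB.instance Definition _ k := [Choice of osimplex k by <:].

Lemma is_osimplex_comp k j (f : 'I_j.+1 -> 'I_k.+1) (v : osimplex k) :
  injective f -> is_osimplex [ffun i => v (f i)].
Proof.
move=> f_inj; have /andP[/injectiveP v_inj Xv] := osimplexP v.
apply/andP; split.
  by apply/injectiveP => a b; rewrite !ffunE => /v_inj /f_inj.
apply: is_simplex_sub Xv _ _.
  apply/fsubsetP => x /imfsetP[i _ ->]; rewrite ffunE.
  by apply/imfsetP; exists (f i).
apply/fset0Pn; exists (v (f ord0)); apply/imfsetP; exists ord0 => //=.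
by rewrite ffunE.
Qed.

Definition osimplex_comp k j (f : 'I_j.+1 -> 'I_k.+1) (f_inj : injective f)
    (v : osimplex k) : osimplex j :=
  OSimplex (is_osimplex_comp v f_inj).

(* [v_(s 0), ..., v_(s k)] *)
Definition osimplex_perm k (v : osimplex k) (s : 'S_k.+1) : osimplex k :=
  osimplex_comp (@perm_inj _ s) v.

Lemma front_inj k l :
  injective (fun i : 'I_k.+1 => inord i : 'I_(k + l).+1).
Proof.
move=> i j /(congr1 val) /=.
by rewrite !inordK ?ltnS ?(leq_trans (leq_ord _)) ?leq_addr// => /val_inj.
Qed.

Lemma back_inj k l :
  injective (fun j : 'I_l.+1 => inord (k + j) : 'I_(k + l).+1).
Proof.
move=> i j /(congr1 val) /=.
by rewrite !inordK ?ltnS ?leq_add2l ?leq_ord// => /addnI /val_inj.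
Qed.

(* [v_0, ..., v_k] and [v_k, ..., v_(k+l)] *)
Definition front_face k l (v : osimplex (k + l)) : osimplex k :=
  osimplex_comp (@front_inj k l) v.
Definition back_face k l (v : osimplex (k + l)) : osimplex l :=
  osimplex_comp (@back_inj k l) v.

Definition ksimplex k := {s : {fset V} | X s && (#|` s| == k.+1)}.

Section Orient.
Variables (k : nat) (s : ksimplex k).

Let size_s : size (val s) == k.+1.
Proof. by case: s => /= t /andP[]. Qed.

Let vs : {ffun 'I_k.+1 -> V} := [ffun i => tnth (Tuple size_s) i].

Let vsP : is_osimplex vs.
Proof.
apply/andP; split.
  apply/injectiveP => i j; rewrite !ffunE.
  exact: (tuple_uniqP (Tuple size_s) (fset_uniq (val s))).
have -> : [fset vs i | i : 'I_k.+1]%fset = val s; last by case/andP: (valP s).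
apply/fsetP => x; apply/imfsetP/idP => [[i _ ->]|xs].
  by rewrite ffunE; exact: (mem_tnth i (Tuple size_s)).
have /tnthP[i xi] : x \in Tuple size_s by [].
by exists i => //; rewrite ffunE.
Qed.

(* An arbitrary choice of an ordering (hence an orientation) of s. *)
Definition orient : osimplex k := OSimplex vsP.

End Orient.
End OrderedSimplices.

Section Cochains.
Import freeg.
Variables (R : realType) (V : choiceType) (X : simplicial_complex V).

(* C_k(X) is the quotient of the free vector space {freeg (osimplex X k) / R}
   on the ordered k-simplices by the relations
   [v_(s 0), ..., v_(s k)] = sgn(s) [v_0, ..., v_k]; its dual is the space of
   linear forms on the free space that respect these relations. *)
Definition oriented k (v : osimplex X k) : {freeg (osimplex X k) / R} := << v >>.

Record cochain k := Cochain {
  eval :> {linear {freeg (osimplex X k) / R} -> R^o};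
  eval_perm : forall (v : osimplex X k) (s : 'S_k.+1),
    eval (oriented (osimplex_perm v s)) = (-1) ^+ s * eval (oriented v) }.

Definition cup k l (a : cochain k) (b : cochain l) (v : osimplex X (k + l)) : R :=
  a (oriented (front_face v)) * b (oriented (back_face v)).

Definition wedge_osimplex k l (a : cochain k) (b : cochain l)
    (v : osimplex X (k + l)) : R :=
  ((k + l).+1)`!%:R^-1 *
  \sum_(t : 'S_(k + l).+1) (-1) ^+ t * cup a b (osimplex_perm v t).

Lemma fglift_is_linear (K : choiceType) (f : K -> R^o) :
  linear (fglift f : {freeg K / R} -> R^o).
Proof.
have fB : {morph (fglift f : {freeg K / R} -> R^o) : x y / x - y}.
  exact: lift_is_additive.
have f0 : fglift f (0 : {freeg K / R}) = 0 by rewrite -(subr0 0) fB subrr.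
have fD : {morph (fglift f : {freeg K / R} -> R^o) : x y / x + y}.
  by move=> x y; rewrite -{1}(opprK y) -(sub0r y) !fB f0 sub0r opprK.
move=> c x y; rewrite fD; congr (_ + _).
rewrite -{2}[x]freeg_sumE -[c *: x]/(fgscale c x) /fgscale.
rewrite !(big_morph _ fD f0) scaler_sumr.
by apply: eq_bigr => z _; rewrite !liftU scalerA.
Qed.

Lemma osimplex_permM k (v : osimplex X k) (s t : 'S_k.+1) :
  osimplex_perm (osimplex_perm v s) t = osimplex_perm v (t * s)%g.
Proof. by apply/val_inj/ffunP => i; rewrite !ffunE permM. Qed.

Section Wedge.
Variables (k l : nat) (a : cochain k) (b : cochain l).

Let wedge_fun (c : {freeg (osimplex X (k + l)) / R}) : R^o :=
  fglift (wedge_osimplex a b : _ -> R^o) c.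

HB.instance Definition _ := GRing.isLinear.Build R
  {freeg (osimplex X (k + l)) / R} R^o _ wedge_fun
  (fglift_is_linear (wedge_osimplex a b : _ -> R^o)).

Let wedge_perm (v : osimplex X (k + l)) (s : 'S_(k + l).+1) :
  wedge_fun (oriented (osimplex_perm v s)) =
    (-1) ^+ s * wedge_fun (oriented v).
Proof.
rewrite /wedge_fun !liftU !scale1r /wedge_osimplex mulrCA; congr (_ * _).
rewrite mulr_sumr (reindex_inj (mulIg s^-1%g)) /=.
apply: eq_bigr => t _.
by rewrite osimplex_permM mulgKV odd_permM odd_permV addbC signr_addb -mulrA.
Qed.

Definition wedge : cochain (k + l) := Cochain wedge_perm.

End Wedge.
End Cochains.

Section Realization.
Variables (R : realType) (V : choiceType) (X : simplicial_complex V).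

(* |X|: a point is the family of its barycentric coordinates. *)
Record realization := Realization {
  bary_coord :> V -> R;
  realizationP : (forall v, 0 <= bary_coord v) /\
    exists s : {fset V}, [/\ X s, forall v, v \notin s -> bary_coord v = 0 &
      \sum_(v <- s) bary_coord v = 1] }.

HB.instance Definition _ := gen_eqMixin realization.
HB.instance Definition _ := gen_choiceMixin realization.

Definition closed_simplex (s : {fset V}) : set realization :=
  [set p | forall v, v \notin s -> p v = 0].

(* The topology of |X| is the one coherent with its closed simplices, each of
   which carries its Euclidean topology, induced here by pointwise convergence
   of the barycentric coordinates. *)
Definition realization_open (U : set realization) : Prop :=
  forall s : {fset V}, X s -> exists2 D : set {ptws V -> R}, open D &
    forall p, closed_simplex s p -> (U p <-> D (bary_coord p)).

Let realization_openT : realization_open setT.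
Proof. by move=> s _; exists setT => //; exact: openT. Qed.

Let realization_openI : setI_closed realization_open.
Proof.
move=> A B oA oB s Xs.
have [D oD AD] := oA s Xs; have [Q oQ BQ] := oB s Xs.
exists (D `&` Q); first exact: openI.
move=> p sp; split=> [[/(AD _ sp) ? /(BQ _ sp) ?]//|[Dp Qp]].
by split; [apply/(AD _ sp)|apply/(BQ _ sp)].
Qed.

Let realization_open_bigU (I : Type) (f : I -> set realization) :
  (forall i, realization_open (f i)) -> realization_open (\bigcup_i f i).
Proof.
move=> of_ s Xs.
have /(@choice _ _)[D DP] : forall i, exists D : set {ptws V -> R}, open D /\
    forall p, closed_simplex s p -> (f i p <-> D (bary_coord p)).
  by move=> i; have [D oD fD] := of_ i s Xs; exists D.
exists (\bigcup_i D i); first by apply: bigcup_open => i _; case: (DP i).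
move=> p sp; split=> -[i _ fip]; exists i => //.
  by case: (DP i) => _ /(_ p sp) [+ _]; exact.
by case: (DP i) => _ /(_ p sp) [_]; exact.
Qed.

HB.instance Definition _ := isOpenTopological.Build realization
  realization_openT realization_openI realization_open_bigU.

End Realization.

(* {x in R^m | x_0 >= 0} (all of R^m when m = 0) *)
Definition half_space (R : realType) m : set 'rV[R]_m :=
  [set x | forall i : 'I_m, i = 0%N :> nat -> 0 <= x ord0 i].

Definition has_chart_at (R : realType) m (T : topologicalType) (p : T) : Prop :=
  exists (U : set T) (D : set 'rV[R]_m) (f : T -> 'rV[R]_m) (g : 'rV[R]_m -> T),
    let W := D `&` @half_space R m in
    [/\ open U /\ U p, open D,
        {within U, continuous f} /\ {within W, continuous g},
        (forall q, U q -> W (f q) /\ g (f q) = q) &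
        (forall x, W x -> U (g x) /\ f (g x) = x)].

(* topological m-manifold, with possibly empty boundary *)
Definition is_manifold (R : realType) m (T : topologicalType) : Prop :=
  [/\ hausdorff_space T, @second_countable T & forall p : T, has_chart_at R m p].

Definition triangulated_manifold (R : realType) (V : choiceType)
    (X : simplicial_complex V) : Prop :=
  exists m, is_manifold R m (realization R X).

Section Forms.
Variables (R : realType) (n : nat).

(* Differential k-forms in n real variables: u_1, ..., u_k are the tangent
   vectors at x. Alternating multilinearity in u is not imposed; it holds for the
   forms built below. *)
Definition form k := 'rV[R]_n -> ('I_k -> 'rV[R]_n) -> R.

Definition dform (f : 'rV[R]_n -> R) : form 1 := fun x u => 'd f x (u ord0).

(* Normalized so that (dx_1 /\ ... /\ dx_n)(e_1, ..., e_n) = 1. *)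
Definition fwedge k l (a : form k) (b : form l) : form (k + l) := fun x u =>
  (k`! * l`!)%:R^-1 * \sum_(s : 'S_(k + l))
    (-1) ^+ s * a x (fun i => u (s (lshift l i))) * b x (fun j => u (s (rshift k j))).

(* a_0 /\ ... /\ a_(k-1) *)
Fixpoint fwedge_all k : ('I_k -> form 1) -> form k :=
  match k with
  | 0 => fun _ _ _ => 1
  | k'.+1 => fun a => fwedge (a ord0) (fwedge_all (fun i => a (lift ord0 i)))
  end.

End Forms.

Section TupleLebesgue.
Variable R : realType.
Local Notation RT := (measurableTypeR R).

Definition tuple_cons n (p : RT * n.-tuple RT) : n.+1.-tuple RT :=
  [tuple of p.1 :: p.2].

Lemma measurable_tuple_cons n : measurable_fun setT (@tuple_cons n).
Proof. exact: measurable_cons measurable_fst measurable_snd. Qed.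

Section Step.
Variables (n : nat) (mu : {sigma_finite_measure set (n.-tuple RT) -> \bar R}).

Definition cons_measure : set (n.+1.-tuple RT) -> \bar R :=
  pushforward (@lebesgue_measure R \x mu)%E (@tuple_cons n).

Let preimage_cons_measurable A : measurable A ->
  measurable (@tuple_cons n @^-1` A).
Proof. by move=> mA; rewrite -[X in measurable X]setTI; exact: measurable_tuple_cons. Qed.

Let cons_measure0 : cons_measure set0 = 0%E.
Proof. by rewrite /cons_measure /pushforward preimage_set0 measure0. Qed.

Let cons_measure_ge0 A : (0 <= cons_measure A)%E.
Proof. by rewrite /cons_measure /pushforward measure_ge0. Qed.

Let cons_measure_sigma_additive : semi_sigma_additive cons_measure.
Proof.
move=> F mF tF mUF; rewrite /cons_measure /pushforward preimage_bigcup.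
apply: measure_semi_sigma_additive => [k||].
- exact: preimage_cons_measurable.
- apply/trivIsetP => /= i j _ _ ij; rewrite -preimage_setI.
  by move/trivIsetP : tF => /(_ _ _ _ _ ij) ->//; rewrite preimage_set0.
- by rewrite -preimage_bigcup; exact: preimage_cons_measurable.
Qed.

HB.instance Definition _ := isMeasure.Build _ _ _ cons_measure
  cons_measure0 cons_measure_ge0 cons_measure_sigma_additive.

Let cons_measure_sigma_finite : sigma_finite setT cons_measure.
Proof.
pose uncons (t : n.+1.-tuple RT) : RT * n.-tuple RT :=
  (thead t, [tuple of behead t]).
have munc : measurable_fun [set: n.+1.-tuple RT] uncons.
  exact: (measurable_fun_pair (measurable_tnth ord0) (@measurable_behead _ _ _)).
have consK : cancel (@tuple_cons n) uncons.
  by case=> x t; congr (_, _); exact/val_inj.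
have /sigma_finiteP[F [FT ndF Foo]] := sigma_finiteT (@lebesgue_measure R).
have /sigma_finiteP[G [GT ndG Goo]] := sigma_finiteT mu.
exists (fun k => uncons @^-1` (F k `*` G k)).
  rewrite -preimage_bigcup (_ : \bigcup_k _ = setT) ?preimage_setT//.
  rewrite -setXTT FT GT; apply/seteqP; split => -[x y] /=.
    by move=> [k _ []/= ? ?]; split; exists k.
  move=> [/= [j _ Fjx] [k _ Gky]]; exists (maxn j k) => //; split.
    by move: x Fjx; exact/subsetPset/ndF/leq_maxl.
  by move: y Gky; exact/subsetPset/ndG/leq_maxr.
move=> k; have [mF Fk] := Foo k; have [mG Gk] := Goo k.
have mFG : measurable (F k `*` G k) by exact: measurableX.
split; first by rewrite -[X in measurable X]setTI; exact: munc.
rewrite /cons_measure /pushforward -comp_preimage.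
rewrite (_ : uncons \o _ = id); last by apply/funext => p; exact: consK.
by rewrite product_measure1E// lte_mul_pinfty// ge0_fin_numE.
Qed.

HB.instance Definition _ := Measure_isSigmaFinite.Build _ _ _ cons_measure
  cons_measure_sigma_finite.
End Step.

(* Lebesgue measure on R^n, as an iterated product measure. *)
Fixpoint tuple_lebesgue n : {sigma_finite_measure set (n.-tuple RT) -> \bar R} :=
  match n with
  | 0 => \d_([tuple] : 0.-tuple RT)
  | n'.+1 => cons_measure (tuple_lebesgue n')
  end.
End TupleLebesgue.

Section WhitneyForms.
Variables (R : realType) (V : choiceType) (X : simplicial_complex V).

(* The affine parametrization of the simplex nu = [v_0, ..., v_n] by R^n, in
   barycentric coordinates: 0 is sent to v_0 and the i-th basis vector to
   v_(i+1). *)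
Definition affine_coord n (x : 'rV[R]_n) (i : 'I_n.+1) : R :=
  if unlift ord0 i is Some j then x ord0 j else 1 - \sum_(j < n) x ord0 j.

Definition simplex_param n (nu : osimplex X n) (x : 'rV[R]_n) : V -> R :=
  fun v => \sum_(i < n.+1 | nu i == v) affine_coord x i.

(* lambda_v restricted to nu, read in the parametrization *)
Definition lambda n (nu : osimplex X n) (v : V) : 'rV[R]_n -> R :=
  fun x => simplex_param nu x v.

(* W sigma restricted to nu *)
Definition whitney_osimplex n (nu : osimplex X n) k (sigma : osimplex X k) :
    form R n k := fun x u =>
  k`!%:R * \sum_(i < k.+1) (-1) ^+ i * lambda nu (sigma i) x *
    fwedge_all (fun j : 'I_k => dform (lambda nu (sigma (lift i j)))) x u.

(* W alpha restricted to nu, where alpha is the sum of the <alpha, sigma> sigma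
   over the k-simplices sigma of X, each with an arbitrary orientation. X may
   be infinite, but W sigma vanishes on nu unless sigma is a face of nu, so
   this sum has finite support, as required by \sum_(_ \in _). *)
Definition whitney n (nu : osimplex X n) k (alpha : cochain R X k) :
    form R n k := fun x u =>
  \sum_(s \in [set: ksimplex X k])
    alpha (oriented R (orient s)) * whitney_osimplex nu (orient s) x u.

Definition std_simplex n : set (n.-tuple (measurableTypeR R)) :=
  [set t | (forall i, 0 <= tnth t i) /\ \sum_(i < n) tnth t i <= 1].

(* The integral of w over an oriented n-simplex, w being read in the
   parametrization, which is orientation-preserving. *)
Definition integral_simplex n (w : form R n n) : \bar R :=
  (\int[tuple_lebesgue R n]_(t in @std_simplex n)
     (w (\row_i tnth t i) (fun i => delta_mx ord0 i))%:E)%E.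

End WhitneyForms.

(* Main.v *)
Require Import Defs.
From HB Require Import structures.
From mathcomp Require Import all_boot all_order all_algebra.
From mathcomp Require Import finmap fingroup perm ring.
From mathcomp Require Import all_classical all_reals all_analysis.
From mathcomp Require Import measurable_realfun.
From mathcomp Require freeg.

(**
Extend a cochain by zero to alternating functions of arbitrary tuples of
vertices. On nu = [v_0, ..., v_n], expanding the determinants in W sigma and
regrouping gives
  W alpha = k! sum_f alpha(v_f(0), ..., v_f(k))
                     lambda_f(0) dlambda_f(1) /\ ... /\ dlambda_f(k)
over all maps f from {0..k} to {0..n}. In W alpha /\ W beta the surviving terms
are those where dlambda_f(1), ..., dlambda_f(k), dlambda_g(1), ..., dlambda_g(l)
are, for a permutation t of {0..n}, dlambda_t(1), ..., dlambda_t(n), whose wedge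
product is sgn(t) dx_1 /\ ... /\ dx_n. Since the integral of lambda_i lambda_j is
(1 + [i = j]) / (n+2)!, it remains to sum, over i and j, the quantities
(1 + [i = j]) T(i, j), where T(i, j) is the sum over t of
sgn(t) alpha(v_t(i), v_t(1), ..., v_t(k)) beta(v_t(j), v_t(k+1), ..., v_t(n)).
Exchanging t(i) or t(j) with another vertex shows that T(0, 0) = T(0, j) = T(i, 0)
for j <= k < i and that the other T(i, j) with (i, j) <> (0, 0) vanish, so the
total is (n+2) T(0, 0), and T(0, 0) is (n+1)! times the antisymmetrized cup
product.
*)

Set Implicit Arguments.
Unset Strict Implicit.
Unset Printing Implicit Defensive.
Import Order.TTheory GRing.Theory Num.Theory.
Import numFieldNormedType.Exports.
Local Open Scope classical_set_scope.
Local Open Scope ring_scope.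

(** * Dirichlet integrals *)

Section Beta.
Variable R : realType.
Implicit Types (c : R) (a b : nat).

(** Integration by parts, done on polynomials by induction on [a], so that the beta integral only
    needs the fundamental theorem of calculus. *)
Lemma beta_primitive c a b : exists Q : {poly R},
  Q^`() = 'X^a * (c%:P - 'X) ^+ b /\
  Q.[c] - Q.[0] = c ^+ (a + b).+1 * (a`! * b`!)%:R / (a + b).+1`!%:R.
Proof.
have dX m : ((c%:P - 'X : {poly R}) ^+ m.+1)^`() = - (m.+1%:R *: (c%:P - 'X) ^+ m).
  by rewrite deriv_exp derivB derivC derivX sub0r mulN1r scaler_nat mulNrn.
have nz m : m.+1%:R != 0 :> R by rewrite pnatr_eq0.
have fnz m : m`!%:R != 0 :> R by rewrite pnatr_eq0 -lt0n fact_gt0.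
elim: a b => [|a IH] b.
  exists (- b.+1%:R^-1 *: (c%:P - 'X) ^+ b.+1); split.
    by rewrite derivZ dX expr0 mul1r scalerN scaleNr opprK scalerA mulVf ?scale1r.
  rewrite !hornerE subrr expr0n /= mulr0 sub0r subr0 mulNr opprK.
  by rewrite factS natrM; field; rewrite fnz nat1r nz.
have [Q [dQ vQ]] := IH b.+1.
(* The derivative of X^(a+1) (c - X)^(b+1) is (a+1) X^a (c - X)^(b+1) - (b+1) X^(a+1) (c - X)^b. [Q]
   is a primitive of X^a (c - X)^(b+1); solving for the last term gives this witness. *)
exists (b.+1%:R^-1 *: (a.+1%:R *: Q - 'X^(a.+1) * (c%:P - 'X) ^+ b.+1)); split.
  rewrite derivZ derivB derivZ derivM derivXn dX dQ /=.
  rewrite mulrN opprD opprK addrA !scaler_nat mulrnAl subrr add0r.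
  by rewrite mulrnAr -[X in _ *: X]scaler_nat scalerA mulVf ?scale1r.
rewrite !hornerE subrr !expr0n /= !(mulr0, mul0r) !subr0.
have -> : (b.+1%:R^-1 * (a.+1%:R * Q.[c]) - b.+1%:R^-1 * (a.+1%:R * Q.[0]) =
   b.+1%:R^-1 * a.+1%:R * (Q.[c] - Q.[0]))%R by rewrite mulrBr !mulrA.
rewrite vQ addnS addSn !factS !natrM.
by field; rewrite fnz nat1r -natrD nat1r -natrD !nz.
Qed.

Lemma beta_integral c a b : 0 <= c ->
  (\int[@lebesgue_measure R]_(x in `[0%R, c]) (x ^+ a * (c - x) ^+ b)%:E)%E =
  (c ^+ (a + b).+1 * (a`! * b`!)%:R / (a + b).+1`!%:R)%:E.
Proof.
rewrite le_eqVlt => /predU1P[<-|c0].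
  by rewrite set_itv1 integral_set1 expr0n /= !mul0r.
have [Q [dQ vQ]] := beta_primitive c a b.
rewrite -vQ EFinB.
rewrite -(@continuous_FTC2 _ (fun x => x ^+ a * (c - x) ^+ b) (horner Q) 0 c c0) //.
- have -> : (fun x => x ^+ a * (c - x) ^+ b) = horner Q^`().
    by apply/funext => x; rewrite dQ !hornerE.
  exact/continuous_subspaceT/continuous_horner.
- split; first by move=> x _; exact: derivable_horner.
  + exact/cvg_at_right_filter/continuous_horner.
  + exact/cvg_at_left_filter/continuous_horner.
- by move=> x _; rewrite -derivE dQ !hornerE.
Qed.
End Beta.

(** * Dirichlet's formula on scaled simplices *)

Section Dirichlet.
Variable R : realType.
Local Notation RT := (measurableTypeR R).
Local Notation mu := (@lebesgue_measure R).

(** The size [c] is a parameter because fixing the first coordinate at [x] leaves a simplex of size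
    [c - x]. *)
Definition scaled_simplex n (c : R) : set (n.-tuple RT) :=
  [set t | (forall i, 0 <= tnth t i) /\ \sum_(i < n) tnth t i <= c].

(** The base of the power [p] is the coordinate of the vertex at the origin; for [c = 1] this is the
    general monomial in the barycentric coordinates. *)
Definition dirichlet_monomial n (c : R) (p : nat) (e : 'I_n -> nat)
    (t : n.-tuple RT) : R :=
  (c - \sum_(i < n) tnth t i) ^+ p * \prod_(i < n) tnth t i ^+ e i.

Lemma measurable_scaled_simplex n c : measurable (@scaled_simplex n c).
Proof.
have -> : @scaled_simplex n c =
    \bigcap_(i in [set: 'I_n]) [set t | 0 <= tnth t i] `&`
    [set t | \sum_(i < n) tnth t i <= c].
  by apply/seteqP; split=> t /= [t0 tc]; split=> // i; [move=> _|]; exact: t0.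
apply: measurableI.
  apply: fin_bigcap_measurable => // i _.
  rewrite -[X in measurable X]setTI.
  have -> : [set t : n.-tuple RT | 0 <= tnth t i] =
      (fun t : n.-tuple RT => tnth t i) @^-1` `[0, +oo[.
    by apply/seteqP; split => t /=; rewrite in_itv /= andbT.
  by apply: measurable_tnth => //; exact: measurable_itv.
rewrite -[X in measurable X]setTI.
have -> : [set t : n.-tuple RT | \sum_(i < n) tnth t i <= c] =
    (fun t : n.-tuple RT => \sum_(i < n) (tnth t i : R)) @^-1` `]-oo, c].
  by apply/seteqP; split => t /=; rewrite in_itv.
suff: measurable_fun setT (fun t : n.-tuple RT => \sum_(i < n) (tnth t i : R)).
  by apply => //; exact: measurable_itv.
by apply: measurable_sum => i; exact: measurable_tnth.
Qed.

Lemma measurable_dirichlet_monomial n c p e D :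
  measurable_fun D (@dirichlet_monomial n c p e).
Proof.
apply: (@measurable_funS _ _ _ _ setT) => //.
apply: measurable_funM.
  apply: measurable_funX; apply: measurable_funB => //.
  by apply: measurable_sum => i; exact: measurable_tnth.
by apply: measurable_prod => i _; apply: measurable_funX; exact: measurable_tnth.
Qed.

Lemma dirichlet_monomial_ge0 n c p e t : scaled_simplex c t ->
  0 <= @dirichlet_monomial n c p e t.
Proof.
move=> [t0 tc]; rewrite mulr_ge0 ?exprn_ge0 ?subr_ge0//.
by apply: prodr_ge0 => i _; rewrite exprn_ge0.
Qed.

Lemma tnth_tuple_cons0 n (x : RT) (t : n.-tuple RT) :
  tnth (tuple_cons (x, t)) ord0 = x.
Proof. by []. Qed.

Lemma tnth_tuple_consS n (x : RT) (t : n.-tuple RT) i :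
  tnth (tuple_cons (x, t)) (lift ord0 i) = tnth t i.
Proof. by rewrite (tnth_nth 0) (tnth_nth 0). Qed.

Lemma sum_tuple_cons n (x : RT) (t : n.-tuple RT) :
  \sum_(i < n.+1) tnth (tuple_cons (x, t)) i = x + \sum_(i < n) tnth t i :> R.
Proof.
by rewrite big_ord_recl tnth_tuple_cons0; under eq_bigr do rewrite tnth_tuple_consS.
Qed.

Lemma scaled_simplex_cons n c (x : RT) (t : n.-tuple RT) :
  scaled_simplex c (tuple_cons (x, t)) <->
  (x \in `[0, c]) /\ scaled_simplex (c - x) t.
Proof.
rewrite /scaled_simplex /mkset sum_tuple_cons lerBrDl in_itv; split.
  move=> [t0 tc]; have x0 := t0 ord0; rewrite tnth_tuple_cons0 in x0.
  have t0' i : 0 <= tnth t i.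
    by have := t0 (lift ord0 i); rewrite tnth_tuple_consS.
  split=> //; apply/andP; split => //; apply: le_trans tc.
  by rewrite lerDl sumr_ge0.
move=> [/andP[x0 xc] [t0 tc]]; split=> // i.
by case: (unliftP ord0 i) => [j|] ->; rewrite ?tnth_tuple_consS.
Qed.

Lemma dirichlet_monomial_cons n c p e (x : RT) (t : n.-tuple RT) :
  @dirichlet_monomial n.+1 c p e (tuple_cons (x, t)) =
  x ^+ e ord0 * dirichlet_monomial (c - x) p (fun i => e (lift ord0 i)) t.
Proof.
rewrite /dirichlet_monomial sum_tuple_cons opprD addrA big_ord_recl mulrCA.
by under [X in _ * (_ * X) = _]eq_bigr do rewrite tnth_tuple_consS.
Qed.

(** Induction on [n]: Tonelli's theorem isolates the first coordinate x, the inner integral is a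
    constant times a power of c - x, and a beta integral remains. *)
Lemma dirichlet_integral n (c : R) p (e : 'I_n -> nat) : 0 <= c ->
  (\int[tuple_lebesgue R n]_(t in scaled_simplex c)
     (dirichlet_monomial c p e t)%:E =
   (c ^+ (n + (p + \sum_(i < n) e i)) * (p`! * \prod_(i < n) (e i)`!)%:R /
     (n + (p + \sum_(i < n) e i))`!%:R)%:E)%E.
Proof.
elim: n c e => [|n IH] c e c0.
  (* R^0 is a point carrying a Dirac mass, and 0 <= c puts this point in the simplex. *)
  rewrite integral_dirac; last first.
  - apply/measurable_EFinP; exact: measurable_dirichlet_monomial.
  - exact: measurable_scaled_simplex.
  rewrite diracE mem_set /=; last by split; [case|rewrite big_ord0].
  rewrite mul1e /dirichlet_monomial !big_ord0 addn0 add0n subr0 mulr1 muln1.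
  by rewrite mulfK// pnatr_eq0 -lt0n fact_gt0.
(* Extension by zero moves the domain into the integrand, so that Tonelli's theorem applies on the
   whole product space. *)
pose h m (a : R) f := (fun t : m.-tuple RT => (dirichlet_monomial a p f t)%:E) \_
  (scaled_simplex a).
have mh m a f : measurable_fun setT (@h m a f).
  apply: (iffLR (measurable_restrictT _ _)); first exact: measurable_scaled_simplex.
  by apply/measurable_EFinP; exact: measurable_dirichlet_monomial.
have h0 m a f t : (0 <= @h m a f t)%E.
  by apply: erestrict_ge0 => {}t st; rewrite lee_fin dirichlet_monomial_ge0.
have mhc : measurable_fun setT (fun z => h n.+1 c e (tuple_cons z)).
  by apply: measurableT_comp; [exact: mh|exact: measurable_tuple_cons].
pose e' (i : 'I_n) := e (lift ord0 i).
have hE x t : h n.+1 c e (tuple_cons (x, t)) =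
    if x \in `[0, c] then ((x ^+ e ord0)%R%:E * h n (c - x)%R e' t)%E else 0%E.
  rewrite /h /patch; have [xs|xs] := boolP (tuple_cons (x, t) \in _).
    have [-> st] : (x \in `[0, c]) /\ scaled_simplex (c - x) t.
      by apply/scaled_simplex_cons; rewrite inE in xs.
    by rewrite mem_set // dirichlet_monomial_cons EFinM.
  case: ifPn => // x0c; case: ifPn; last by rewrite mule0.
  rewrite inE => st; case/negP: xs; rewrite inE.
  by apply/scaled_simplex_cons.
transitivity (\int[mu]_x \int[tuple_lebesgue R n]_t
    h n.+1 c e (tuple_cons (x, t)))%E.
  rewrite integral_mkcond -/(h n.+1 c e).
  rewrite [LHS](ge0_integral_pushforward (@measurable_tuple_cons _ _)) //.
    by rewrite preimage_setT [LHS]fubini_tonelli1 // => -[x t] /=; exact: h0.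
  exact: mh.
transitivity (\int[mu]_(x in `[0%R, c]) ((x ^+ e ord0)%R%:E *
    \int[tuple_lebesgue R n]_(t in scaled_simplex (c - x)%R)
       (dirichlet_monomial (c - x)%R p e' t)%:E))%E.
  rewrite [RHS]integral_mkcond; apply: eq_integral => x _.
  under eq_integral do rewrite hE.
  rewrite patchE mem_setE /=; case: ifPn => [x0c|_]; last exact: integral0.
  rewrite [X in (_ * X)%E]integral_mkcond ge0_integralZl_EFin //.
    exact: mh.
  by rewrite exprn_ge0//; move: x0c; rewrite in_itv => /andP[].
set N := (n + (p + \sum_(i < n) e' i))%N.
pose K : R := (p`! * \prod_(i < n) (e' i)`!)%:R / N`!%:R.
transitivity (\int[mu]_(x in `[0%R, c]) (K%:E * (x ^+ e ord0 * (c - x) ^+ N)%R%:E))%E.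
  apply: eq_integral => x; rewrite inE /= in_itv /= => /andP[x0 xc].
  by rewrite IH ?subr_ge0// -/N -!EFinM /K; congr EFin; ring.
rewrite ge0_integralZl_EFin //; last 3 first.
- move=> x /=; rewrite in_itv /= => /andP[x0 xc].
  by rewrite lee_fin mulr_ge0 ?exprn_ge0// subr_ge0.
- apply/measurable_EFinP; apply: measurable_funM; apply: measurable_funX => //.
  exact: measurable_funB.
- by rewrite divr_ge0.
rewrite beta_integral// -EFinM; congr EFin.
rewrite !big_ord_recl -/N /K.
have -> : (n.+1 + (p + (e ord0 + \sum_(i < n) e (lift ord0 i))) = (e ord0 + N).+1)%N.
  by rewrite /N addSn (addnCA p) (addnCA n).
have f_neq0 m : m`!%:R != 0 :> R by rewrite pnatr_eq0 -lt0n fact_gt0.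
have := f_neq0 (e ord0 + N).+1; have := f_neq0 N.
move: (N`!) ((e ord0 + N).+1`!) => u v u0 v0; rewrite !natrM.
by field; rewrite u0 v0.
Qed.
End Dirichlet.

(** * Integrals of products of two barycentric coordinates *)

Section QuadraticMoments.
Variable R : realType.
Local Notation RT := (measurableTypeR R).

Let prodr_expb n (x : 'I_n -> R) (i : 'I_n) :
  \prod_(a < n) x a ^+ (i == a) = x i.
Proof.
rewrite (bigD1 i) //= eqxx big1 ?mulr1// => a /negbTE ai.
by rewrite eq_sym ai.
Qed.

Lemma affine_coord_monomial n (t : n.-tuple RT) (f : 'I_n.+1 -> nat) :
  dirichlet_monomial 1 (f ord0) (fun a => f (lift ord0 a)) t =
  \prod_(a < n.+1) affine_coord (\row_b tnth t b) a ^+ f a.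
Proof.
rewrite big_ord_recl /affine_coord unlift_none /dirichlet_monomial.
under [in RHS]eq_bigr do rewrite mxE.
by congr (_ * _); apply: eq_bigr => a _; rewrite liftK mxE.
Qed.

(** The integrand is the monomial with exponents [i = a] + [j = a], of degree 2; the product of the
    factorials of its exponents is 2 if i = j and 1 otherwise. *)
Lemma integral_affine_coordM n (i j : 'I_n.+1) :
  (\int[tuple_lebesgue R n]_(t in @std_simplex R n)
     (affine_coord (\row_a tnth t a) i * affine_coord (\row_a tnth t a) j)%:E =
   ((1 + (i == j)%:R) / (n.+2)`!%:R)%:E)%E.
Proof.
pose f a := ((i == a) + (j == a))%N.
transitivity (\int[tuple_lebesgue R n]_(t in scaled_simplex 1%R)
    (dirichlet_monomial 1%R (f ord0) (fun a => f (lift ord0 a)) t)%:E)%E.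
  apply: eq_integral => t _; rewrite affine_coord_monomial.
  under eq_bigr do rewrite exprD.
  by rewrite big_split /= !prodr_expb.
rewrite dirichlet_integral ?ler01// expr1n mul1r.
have -> : (f ord0 + \sum_(a < n) f (lift ord0 a) = 2)%N.
  have sum1 (k : 'I_n.+1) : (\sum_(a < n.+1) (k == a) = 1)%N.
    by rewrite (bigD1 k) //= eqxx big1 // => a /negbTE; rewrite eq_sym => ->.
  by rewrite -big_ord_recl /f big_split /= !sum1.
have -> : ((f ord0)`! * \prod_(a < n) (f (lift ord0 a))`! = 1 + (i == j))%N.
  rewrite -(big_ord_recl _ (fun a => (f a)`!)) /f; have [<-|ij] := eqVneq i j.
    rewrite (bigD1 i) //= eqxx big1 // => a /negbTE ai.
    by rewrite eq_sym ai.
  rewrite big1 // => a _; have [ia|_] := eqVneq i a; last by case: eqP.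
  by rewrite -ia eq_sym (negbTE ij).
by rewrite addn2 natrD.
Qed.

Lemma integral_affine_coord_quadratic n (C : 'I_n.+1 -> 'I_n.+1 -> R) :
  (\int[tuple_lebesgue R n]_(t in @std_simplex R n)
     (\sum_(i < n.+1) \sum_(j < n.+1) C i j *
       (affine_coord (\row_a tnth t a) i * affine_coord (\row_a tnth t a) j))%:E =
   (\sum_(i < n.+1) \sum_(j < n.+1) C i j * ((1 + (i == j)%:R) / (n.+2)`!%:R))%:E)%E.
Proof.
pose q i j (t : n.-tuple RT) : R :=
  affine_coord (\row_a tnth t a) i * affine_coord (\row_a tnth t a) j.
have mS : measurable (@std_simplex R n) := @measurable_scaled_simplex R n 1.
have mc i : measurable_fun (@std_simplex R n)
    (fun t : n.-tuple RT => affine_coord (\row_a tnth t a : 'rV[R]_n) i).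
  apply: (@measurable_funS _ _ _ _ setT) => //.
  rewrite /affine_coord; case: unlift => [a|].
    by under eq_fun do rewrite mxE; exact: measurable_tnth.
  under eq_fun do under eq_bigr do rewrite mxE.
  by apply: measurable_funB => //; apply: measurable_sum => a; exact: measurable_tnth.
have q0 i j t : std_simplex t -> 0 <= q i j t.
  have c0 a : std_simplex t -> 0 <= affine_coord (\row_b tnth t b) a.
    move=> [t0 t1]; rewrite /affine_coord; case: unlift => [b|]; first by rewrite mxE.
    by rewrite subr_ge0; under eq_bigr do rewrite mxE.
  by move=> ts; rewrite mulr_ge0 ?c0.
(* As [q i j] is nonnegative on the simplex, the finite value already computed for its integral
   gives integrability. *)
have iq i j : (tuple_lebesgue R n).-integrable (@std_simplex R n) (EFin \o q i j).
  apply/integrableP; split.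
    by apply/measurable_EFinP; exact: measurable_funM.
  under eq_integral => t.
    rewrite inE => ts; rewrite /= ger0_norm ?q0//.
    over.
  by rewrite integral_affine_coordM ltry.
have iCq i j : (tuple_lebesgue R n).-integrable (@std_simplex R n)
    (fun t => (C i j)%:E * (q i j t)%:E)%E.
  by apply: integrableZl => //; exact: iq.
under eq_integral do rewrite pair_big /= -sumEFin.
rewrite pair_big /= -sumEFin integral_sum //=; last by move=> [i j]; exact: iCq.
apply: eq_bigr => -[i j] _ /=; rewrite EFinM -integral_affine_coordM.
by rewrite -integralZl//; exact: iq.
Qed.

End QuadraticMoments.

(** * Alternating sums over permutations *)

Section AlternatingSums.
Variable R : numDomainType.

Definition alternating m (T : Type) (A : ('I_m -> T) -> R) :=
  forall f (s : 'S_m), A (f \o s) = (-1) ^+ s * A f.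

(** The transposition of [i] and [j] fixes [f] and has sign -1, so A f = - A f. *)
Lemma alternating_eq0 m T (A : ('I_m -> T) -> R) f i j :
  alternating A -> i != j -> f i = f j -> A f = 0.
Proof.
move=> altA ij fij; have := altA f (tperm i j).
have -> : f \o tperm i j = f by apply/funext => x /=; case: tpermP => // ->.
by rewrite odd_tperm ij expr1 mulN1r => /eqP; rewrite eq_sym eqNr => /eqP.
Qed.

Definition fcons T m (i : T) (f : 'I_m -> T) (x : 'I_m.+1) : T :=
  if unlift ord0 x is Some y then f y else i.

Lemma fcons0 T m (i : T) (f : 'I_m -> T) : fcons i f ord0 = i.
Proof. by rewrite /fcons unlift_none. Qed.

Lemma fconsS T m (i : T) (f : 'I_m -> T) y : fcons i f (lift ord0 y) = f y.
Proof. by rewrite /fcons liftK. Qed.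

Lemma comp_fcons T U (g : T -> U) m (i : T) (f : 'I_m -> T) :
  g \o fcons i f = fcons (g i) (g \o f).
Proof. by apply/funext => x; rewrite /fcons /=; case: unlift. Qed.

Lemma fcons_inj (T : eqType) m (i : T) (f : 'I_m -> T) : injective f ->
  (forall x, f x != i) -> injective (fcons i f).
Proof.
move=> f_inj fi x y; case: (unliftP ord0 x) => [x'|] ->;
  case: (unliftP ord0 y) => [y'|] ->; rewrite ?fcons0 ?fconsS //.
- by move=> /f_inj ->.
- by move/eqP; rewrite (negbTE (fi _)).
- by move/esym/eqP; rewrite (negbTE (fi _)).
Qed.

Section Pairing.
Variables (N k l : nat) (A : ('I_k -> 'I_N) -> R) (B : ('I_l -> 'I_N) -> R).
Hypotheses (altA : alternating A) (altB : alternating B).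

(** The sums T(i, j) of the overview are the values at the lists [front_cons i] and [back_cons j]
    defined below. *)
Definition altsum (p : 'I_k -> 'I_N) (q : 'I_l -> 'I_N) : R :=
  \sum_(t : 'S_N) (-1) ^+ t * (A (t \o p) * B (t \o q)).

Lemma altsum_perm (s : 'S_N) p q :
  altsum (s \o p) (s \o q) = (-1) ^+ s * altsum p q.
Proof.
rewrite /altsum mulr_sumr [RHS](reindex_inj (mulgI s)); apply: eq_bigr => t _.
rewrite odd_permM signr_addb !mulrA -expr2 sqrr_sign mul1r -!mulrA.
have comp_s m (r : 'I_m -> 'I_N) : t \o (s \o r) = (s * t)%g \o r.
  by apply/funext => x; rewrite /= permM.
by rewrite !comp_s.
Qed.

(** If [s] carries the lists [p], [q] to reorderings of [p'], [q'], alternation turns these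
    reorderings into signs. Every symmetry of T below is an instance in which [s] is a
    transposition. *)
Lemma altsum_permAB (s : 'S_N) (r : 'S_k) (r' : 'S_l) p q p' q' :
  s \o p = p' \o r -> s \o q = q' \o r' ->
  (-1) ^+ s * altsum p q = (-1) ^+ r * ((-1) ^+ r' * altsum p' q').
Proof.
move=> sp sq; rewrite -altsum_perm sp sq /altsum !mulr_sumr.
apply: eq_bigr => t _; rewrite (altA (t \o p') r : A (t \o (p' \o r)) = _).
rewrite (altB (t \o q') r' : B (t \o (q' \o r')) = _) mulrACA !mulrA.
by congr (_ * _ * _); rewrite -[LHS]mulrA [LHS]mulrC.
Qed.

Lemma altsum_eq0l p q i j : i != j -> p i = p j -> altsum p q = 0.
Proof.
move=> ij pij; apply: big1 => t _.
by rewrite (alternating_eq0 altA ij) ?mul0r ?mulr0//= pij.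
Qed.

Lemma altsum_eq0r p q i j : i != j -> q i = q j -> altsum p q = 0.
Proof.
move=> ij qij; apply: big1 => t _.
by rewrite (alternating_eq0 altB ij) ?mulr0//= qij.
Qed.

End Pairing.

(** * The symmetries of T(i, j) *)

Section Split.
Variables (k l : nat).
Variables (A : ('I_k.+1 -> 'I_(k + l).+1) -> R) (B : ('I_l.+1 -> 'I_(k + l).+1) -> R).
Hypotheses (altA : alternating A) (altB : alternating B).
Local Notation lidx x := (lift ord0 (lshift l x)).
Local Notation ridx y := (lift ord0 (rshift k y)).

Definition front_cons i : 'I_k.+1 -> 'I_(k + l).+1 := fcons i (fun x => lidx x).
Definition back_cons j : 'I_l.+1 -> 'I_(k + l).+1 := fcons j (fun y => ridx y).

Let lidx_inj : injective (fun x : 'I_k => lidx x).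
Proof. by move=> x y /lift_inj /lshift_inj. Qed.
Let ridx_inj : injective (fun x : 'I_l => ridx x).
Proof. by move=> x y /lift_inj /rshift_inj. Qed.
Let lidx_neq_ridx x y : lidx x != ridx y.
Proof. by rewrite (inj_eq lift_inj) eq_lrshift. Qed.

Let T i j := altsum A B (front_cons i) (back_cons j).

(** The head of the front list already occurs in its tail. *)
Let T_lidx x j : T (lidx x) j = 0.
Proof.
by apply: (@altsum_eq0l _ _ _ _ _ altA _ _ ord0 (lift ord0 x));
  rewrite // /front_cons fcons0 fconsS.
Qed.

Let T_ridx i y : T i (ridx y) = 0.
Proof.
by apply: (@altsum_eq0r _ _ _ _ _ altB _ _ ord0 (lift ord0 y));
  rewrite // /back_cons fcons0 fconsS.
Qed.

Let front_cons_tperm i x : (forall x', lidx x' != i) ->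
  tperm i (lidx x) \o front_cons i = front_cons i \o tperm ord0 (lift ord0 x).
Proof.
move=> xi; apply/funext => z.
rewrite /front_cons /= (inj_tperm _ _ _ (fcons_inj lidx_inj xi)).
by rewrite fcons0 fconsS.
Qed.

Let back_cons_tperm j y : (forall y', ridx y' != j) ->
  tperm j (ridx y) \o back_cons j = back_cons j \o tperm ord0 (lift ord0 y).
Proof.
move=> yj; apply/funext => z.
rewrite /back_cons /= (inj_tperm _ _ _ (fcons_inj ridx_inj yj)).
by rewrite fcons0 fconsS.
Qed.

Let odd_tperm0 m (x : 'I_m) : odd_perm (tperm ord0 (lift ord0 x)).
Proof. by rewrite odd_tperm. Qed.

(** Exchanging 0 and [lidx x] transposes two entries of the front list and makes 0 the head of the
    back list; the signs of the exchange and of the reordering cancel. *)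
Let T_0l x : T ord0 (lidx x) = T ord0 ord0.
Proof.
have := @altsum_permAB _ _ _ A B altA altB (tperm ord0 (lidx x))
  (tperm ord0 (lift ord0 x)) 1%g (front_cons ord0) (back_cons (lidx x))
  (front_cons ord0) (back_cons ord0).
rewrite !odd_tperm0 odd_perm1 expr0 mul1r => E; apply: (mulrI (unitrN1 _)).
apply: E; first exact: front_cons_tperm.
apply/funext => z; rewrite /back_cons /fcons /= perm1.
case: unlift => [y|]; last by rewrite tpermR.
by rewrite tpermD // lidx_neq_ridx.
Qed.

Let T_r0 y : T (ridx y) ord0 = T ord0 ord0.
Proof.
have := @altsum_permAB _ _ _ A B altA altB (tperm ord0 (ridx y))
  1%g (tperm ord0 (lift ord0 y)) (front_cons (ridx y)) (back_cons ord0)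
  (front_cons ord0) (back_cons ord0).
rewrite !odd_tperm0 odd_perm1 expr0 mul1r => E; apply: (mulrI (unitrN1 _)).
apply: E; last exact: back_cons_tperm.
apply/funext => z; rewrite /front_cons /fcons /= perm1.
case: unlift => [x|]; last by rewrite tpermR.
by rewrite tpermD // eq_sym lidx_neq_ridx.
Qed.

(** Exchanging the two heads transposes two entries in each list: the sign -1 on one side meets
    (-1)(-1) on the other, so T is its own opposite. *)
Let T_rl y x : T (ridx y) (lidx x) = 0.
Proof.
have := @altsum_permAB _ _ _ A B altA altB (tperm (ridx y) (lidx x))
  (tperm ord0 (lift ord0 x)) (tperm ord0 (lift ord0 y))
  (front_cons (ridx y)) (back_cons (lidx x)) (front_cons (ridx y)) (back_cons (lidx x)).
rewrite !odd_tperm0 odd_tperm eq_sym lidx_neq_ridx expr1 !mulN1r opprK => E.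
apply/eqP; rewrite -eqNr /T E //.
  by apply: front_cons_tperm => x'; exact: lidx_neq_ridx.
by rewrite tpermC; apply: back_cons_tperm => y'; rewrite eq_sym lidx_neq_ridx.
Qed.

(** The value T(0, 0) occurs with weight 2 at (0, 0), and with weight 1 at the k pairs (0, j) with 0
    < j <= k and at the l pairs (i, 0) with i > k. *)
Lemma sum_altsum_cons :
  \sum_i \sum_j altsum A B (front_cons i) (back_cons j) * (1 + (i == j)%:R) =
  (k + l).+2%:R * altsum A B (front_cons ord0) (back_cons ord0).
Proof.
have sum_split (F : 'I_(k + l).+1 -> R) :
    \sum_j F j = F ord0 + (\sum_x F (lidx x) + \sum_y F (ridx y)).
  by rewrite big_ord_recl big_split_ord.
have T2 : \sum_j T ord0 j * (1 + (ord0 == j)%:R) = (2 + k)%:R * T ord0 ord0.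
  rewrite sum_split [X in _ + (_ + X)]big1; last by move=> y _; rewrite T_ridx mul0r.
  under eq_bigr do rewrite T_0l /= addr0 mulr1.
  by rewrite eqxx sumr_const card_ord addr0 natrD mulrDl
     mulr_natl mulr2n mulrDr mulr1 mulr_natl.
have T1 y : \sum_j T (ridx y) j * (1 + (ridx y == j)%:R) = T ord0 ord0.
  rewrite sum_split big1 => [|x _]; last by rewrite T_rl mul0r.
  rewrite big1 => [|y' _]; last by rewrite T_ridx mul0r.
  by rewrite T_r0 /= !addr0 mulr1.
rewrite sum_split T2 big1 ?add0r; last first.
  by move=> x _; apply: big1 => j _; rewrite -/(T _ _) T_lidx mul0r.
under eq_bigr do rewrite T1.
by rewrite sumr_const card_ord -[T _ _ *+ l]mulr_natl -mulrDl -natrD -addnA.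
Qed.

Definition front_index (x : 'I_k.+1) : 'I_(k + l).+1 := inord x.
Definition back_index (y : 'I_l.+1) : 'I_(k + l).+1 := inord (k + y).

(** The lists of the cup product share the index k, those of T(0, 0) the index 0. Exchanging 0 and k
    passes from one back list to the other and transposes the two ends of the front list. *)
Lemma altsum_front_back :
  altsum A B front_index back_index = altsum A B (front_cons ord0) (back_cons ord0).
Proof.
have frontE : front_index = front_cons ord0.
  apply/funext => x; apply: val_inj; rewrite /front_index /= inordK; last first.
    by rewrite ltnS (leq_trans (leq_ord _)) ?leq_addr.
  by rewrite /front_cons; case: (unliftP ord0 x) => [x'|] ->; rewrite ?fcons0 ?fconsS.
have back_val y : back_index y = (k + y)%N :> nat.
  by rewrite inordK // ltnS leq_add2l leq_ord.
have back0 : back_index ord0 = front_index ord_max.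
  by apply: val_inj; rewrite /= back_val addn0 inordK // ltnS leq_addr.
rewrite -frontE; pose s := tperm ord0 (back_index ord0).
have := @altsum_permAB _ _ _ A B altA altB s (tperm ord0 ord_max) 1%g
  front_index back_index front_index (back_cons ord0).
have front_inj : injective front_index.
  by rewrite frontE; apply: fcons_inj.
have front0 : front_index ord0 = ord0 by rewrite frontE /front_cons fcons0.
(* For k = 0 the exchange is the identity; keeping both signs as the same power of -1 avoids a case
   distinction. *)
rewrite !odd_tperm back0 -[X in X != front_index _]front0 (inj_eq front_inj).
rewrite odd_perm1 expr0 mul1r => E; apply: (mulrI _ (E _ _)).
- by rewrite unitrX// unitrN1.
- apply/funext => x; rewrite /s /= back0 -[X in tperm X]front0.
  by rewrite (inj_tperm _ _ _ front_inj).
- apply/funext => y; rewrite /= perm1 /back_cons /s.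
  case: (unliftP ord0 y) => [y'|] ->; last by rewrite fcons0 tpermR.
  rewrite fconsS tpermD.
  + by apply: val_inj; rewrite /= back_val /bump /= add1n addnS.
  + by rewrite -val_eqE /= back_val addnS.
  + by rewrite -val_eqE /= !back_val addn0 -[X in X != _]addn0 eqn_add2l.
Qed.
End Split.
End AlternatingSums.

(** * Sums over lists of indices *)

Section FfunSums.
Variables (R : nmodType) (I : finType).

Lemma sum_ffun_cons m (F : ('I_m.+1 -> I) -> R) :
  \sum_(f : {ffun 'I_m.+1 -> I}) F f =
  \sum_i \sum_(g : {ffun 'I_m -> I}) F (fcons i g).
Proof.
rewrite pair_big /=.
rewrite (reindex (fun p : I * {ffun 'I_m -> I} => [ffun x => fcons p.1 p.2 x])) /=.
  by apply: eq_bigr => p _; congr F; apply/funext => x; rewrite ffunE.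
exists (fun f => (f ord0, [ffun x => f (lift ord0 x)])) => [[i g]|f] _ /=.
  congr (_, _); first by rewrite ffunE fcons0.
  by apply/ffunP => x; rewrite !ffunE fconsS.
apply/ffunP => x; rewrite ffunE.
by case: (unliftP ord0 x) => [y|] ->; rewrite ?fcons0 ?fconsS ?ffunE.
Qed.

(** The concatenation of [f] and [g], inverse to restriction along [lshift] and [rshift]. *)
Definition fsplit k l (f : 'I_k -> I) (g : 'I_l -> I) (x : 'I_(k + l)) : I :=
  match fintype.split x with inl y => f y | inr y => g y end.

Lemma sum_ffun_split k l (F : ('I_k -> I) -> ('I_l -> I) -> R) :
  \sum_(f : {ffun 'I_k -> I}) \sum_(g : {ffun 'I_l -> I}) F f g =
  \sum_(h : {ffun 'I_(k + l) -> I}) F (h \o @lshift k l) (h \o @rshift k l).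
Proof.
rewrite pair_big /= (reindex (fun h : {ffun 'I_(k + l) -> I} =>
  ([ffun x => h (lshift l x)], [ffun y => h (rshift k y)]))) /=.
  by apply: eq_bigr => h _; congr F; apply/funext => x; rewrite ffunE.
exists (fun p : {ffun _} * {ffun _} => [ffun x => fsplit p.1 p.2 x]) => [h|[f g]] _ /=.
  apply/ffunP => x; rewrite ffunE /fsplit -[in RHS](fintype.splitK x).
  by case: fintype.split => y /=; rewrite ffunE.
congr (_, _); apply/ffunP => x; rewrite !ffunE /fsplit.
  by rewrite (fintype.unsplitK (inl x)).
by rewrite (fintype.unsplitK (inr x)).
Qed.
End FfunSums.

(** An injection into a set with one more element misses a value, which becomes the image of 0. *)
Lemma lift_perm_ex n (h : 'I_n -> 'I_n.+1) : injective h ->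
  exists t : 'S_n.+1, t \o lift ord0 = h.
Proof.
move=> h_inj.
have [m hm] : exists m, forall x, h x != m.
  have : (#|codom h| < #|'I_n.+1|)%N by rewrite card_codom // !card_ord.
  rewrite ltnNge => /negP hcard; have [/existsP[m /forallP hm]|] :=
    boolP [exists m, forall x, h x != m]; first by exists m.
  rewrite negb_exists => /forallP hsurj; case: hcard; apply: subset_leq_card.
  apply/fintype.subsetP => y _; have := hsurj y; rewrite negb_forall => /existsP[x].
  by rewrite negbK => /eqP <-; exact: codom_f.
exists (perm (fcons_inj h_inj hm)).
by apply/funext => x; rewrite /= permE fconsS.
Qed.

(** * Determinants of differentials of barycentric coordinates *)

Section CoordDifferentials.
Variable R : comNzRingType.

(** The differential of [affine_coord _ i], which does not depend on the point. *)
Definition dcoord n (i : 'I_n.+1) (u : 'rV[R]_n) : R :=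
  if unlift ord0 i is Some j then u ord0 j else - \sum_(j < n) u ord0 j.

Lemma sum_dcoord n (u : 'rV[R]_n) : \sum_i dcoord i u = 0.
Proof.
rewrite big_ord_recl /dcoord unlift_none.
by under [X in _ + X]eq_bigr do rewrite liftK; rewrite addNr.
Qed.

(** This is dlambda_t(1) /\ ... /\ dlambda_t(n) on the standard basis. Bordering the matrix brings
    in all n+1 coordinates; the row permutation gives the sign, and a matrix of determinant 1
    remains. *)
Lemma det_dcoord n (t : 'S_n.+1) :
  \det (\matrix_(i, j) dcoord (t (lift ord0 i)) (delta_mx ord0 j)) = (-1) ^+ t :> R.
Proof.
(* Column 0 marks the row t(0), absent from the original matrix; [row_perm t] moves the mark to row
   0, where cofactor expansion along column 0 recovers that matrix. *)
pose N : 'M[R]_n.+1 := \matrix_(i, j)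
  if unlift ord0 j is Some j' then dcoord i (delta_mx ord0 j') else (i == t ord0)%:R.
have <- : \det (row_perm t N) =
    \det (\matrix_(i, j) dcoord (t (lift ord0 i)) (delta_mx ord0 j)).
  rewrite (expand_det_col _ ord0) (bigD1 ord0) //= big1 ?addr0 => [|i i0]; last first.
    by rewrite !mxE unlift_none (inj_eq perm_inj) (negbTE i0) mul0r.
  rewrite !mxE unlift_none eqxx mul1r /cofactor expr0 mul1r.
  by congr (\det _); apply/matrixP => i j; rewrite !mxE liftK.
rewrite row_permE det_mulmx det_perm -[RHS]mulr1; congr (_ * _).
(* Left multiplication by [U] adds all other rows to row 0, which becomes (1, 0, ..., 0) because the
   differentials sum to zero; the product is lower triangular with unit diagonal. *)
pose U : 'M[R]_n.+1 := \matrix_(i, j) ((i == j) || (i == ord0))%:R.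
have UN i j : (U *m N) i j = if i == ord0 then (j == ord0)%:R else N i j.
  rewrite mxE; case: eqVneq => [->|i0].
    under eq_bigr do rewrite mxE eqxx orbT mul1r mxE.
    case: (unliftP ord0 j) => [j'|] -> /=; first by rewrite sum_dcoord.
    by rewrite (bigD1 (t ord0)) //= eqxx big1 ?addr0// => a /negbTE ->.
  rewrite (bigD1 i) //= mxE eqxx mul1r big1 ?addr0 // => a /negbTE ai.
  by rewrite mxE eq_sym ai (negbTE i0) mul0r.
have detU : \det U = 1.
  rewrite -det_tr det_trig; first by rewrite big1 // => i _; rewrite !mxE eqxx.
  apply/is_trig_mxP => i j ij; rewrite !mxE.
  have -> : (j == i) = false by apply/negbTE; rewrite -val_eqE /= gtn_eqF.
  by rewrite -val_eqE /= gtn_eqF // (leq_ltn_trans _ ij).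
rewrite -[LHS]mul1r -[X in X * _]detU -det_mulmx det_trig.
  apply: big1 => i _; rewrite UN; case: (unliftP ord0 i) => [i'|] ->; last by rewrite eqxx.
  by rewrite !mxE /= liftK /dcoord liftK mxE !eqxx.
apply/is_trig_mxP => i j ij; rewrite UN; move: ij.
case: (unliftP ord0 j) => [j'|] -> //; case: (unliftP ord0 i) => [i'|] -> //= ij.
rewrite mxE liftK /dcoord liftK mxE eqxx /=.
by have -> : (i' == j') = false by apply/negbTE; rewrite -val_eqE /= ltn_eqF.
Qed.

(** A repeated value of [h] gives two equal rows, so only injective [h] count, and each is the tail
    of exactly one permutation. *)
Lemma sum_det_dcoord n (G : ('I_n -> 'I_n.+1) -> R) :
  \sum_(h : {ffun 'I_n -> 'I_n.+1})
     G h * \det (\matrix_(i, j) dcoord (h i) (delta_mx ord0 j)) =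
  \sum_(t : 'S_n.+1) (-1) ^+ t * G (t \o lift ord0).
Proof.
rewrite (bigID (fun h : {ffun 'I_n -> 'I_n.+1} => injectiveb h)) /=.
rewrite [X in _ + X]big1 ?addr0; last first.
  move=> h /injectivePn[x [y xy hxy]].
  by rewrite (determinant_alternate xy) ?mulr0 // => j; rewrite !mxE hxy.
pose r (t : 'S_n.+1) : {ffun 'I_n -> 'I_n.+1} := [ffun x => t (lift ord0 x)].
have rE t : r t = t \o lift ord0 :> (_ -> _) by apply/funext => x; rewrite ffunE.
(* A permutation is determined by its values away from 0. *)
have r_inj : injective r.
  move=> t s /ffunP ts.
  have {}ts x : t (lift ord0 x) = s (lift ord0 x) by have := ts x; rewrite !ffunE.
  apply/permP => x; case: (unliftP ord0 x) => [y|] -> //.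
  apply/eqP/negP => /negP st.
  have [y] : exists y, t ord0 = s y by exists (s^-1 (t ord0))%g; rewrite permKV.
  case: (unliftP ord0 y) => [z|] -> e; last by rewrite e eqxx in st.
  by move: e; rewrite -ts => /perm_inj.
transitivity (\sum_(h in r @: [set: 'S_n.+1]%SET) G h *
    \det (\matrix_(i, j) dcoord (h i) (delta_mx ord0 j))).
  apply: eq_bigl => h; apply/injectiveP/imsetP => [/lift_perm_ex[t th]|[t _ ->]].
    by exists t; [rewrite inE|apply/ffunP => x; rewrite ffunE -th].
  by rewrite rE; apply: inj_comp; [exact: perm_inj|exact: lift_inj].
rewrite big_imset /=; last by move=> ? ? _ _; exact: r_inj.
apply: eq_big => [t|t _]; first by rewrite inE.
rewrite rE mulrC -(det_dcoord t); congr (\det _ * _).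
Qed.
End CoordDifferentials.

(** Cut [f] and [g] into heads i, j and tails. The determinant sees only the concatenated tails, and
    [sum_det_dcoord] makes these the tail of a permutation t. *)
Lemma wedge_coefficient_sum (R : numDomainType) k l
    (A : ('I_k.+1 -> 'I_(k + l).+1) -> R) (B : ('I_l.+1 -> 'I_(k + l).+1) -> R) :
  alternating A -> alternating B ->
  \sum_(f : {ffun 'I_k.+1 -> 'I_(k + l).+1}) \sum_(g : {ffun 'I_l.+1 -> 'I_(k + l).+1})
    A f * B g * (1 + (f ord0 == g ord0)%:R) *
    \det (\matrix_(i, j) dcoord
      (fsplit (f \o lift ord0) (g \o lift ord0) i) (delta_mx ord0 j)) =
  (k + l).+2%:R * altsum A B (@front_index k l) (@back_index k l).
Proof.
move=> altA altB; rewrite altsum_front_back // -sum_altsum_cons //.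
set n := (k + l)%N in A B altA altB *.
pose D (h : 'I_n -> 'I_n.+1) : R := \det (\matrix_(i, j) dcoord (h i) (delta_mx ord0 j)).
pose G i j (h : 'I_n -> 'I_n.+1) := A (fcons i (h \o @lshift k l)) *
  B (fcons j (h \o @rshift k l)) * (1 + (i == j)%:R).
pose E f g := A f * B g * (1 + (f ord0 == g ord0)%:R) *
  D (@fsplit _ k l (f \o lift ord0) (g \o lift ord0)).
have fcons_tail (i : 'I_n.+1) m (f : 'I_m -> 'I_n.+1) : fcons i f \o lift ord0 = f.
  by apply/funext => x; rewrite /= fconsS.
have fsplitK (h : 'I_n -> 'I_n.+1) : fsplit (h \o @lshift k l) (h \o @rshift k l) = h.
  by apply/funext => x; rewrite /fsplit -[in RHS](fintype.splitK x); case: fintype.split.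
transitivity (\sum_i \sum_j \sum_(h : {ffun 'I_n -> 'I_n.+1}) G i j h * D h).
  rewrite (sum_ffun_cons (fun f => \sum_(g : {ffun 'I_l.+1 -> 'I_n.+1}) E f g)).
  apply: eq_bigr => i _.
  under eq_bigr do rewrite (sum_ffun_cons (E _)).
  rewrite exchange_big; apply: eq_bigr => j _ /=.
  rewrite (sum_ffun_split (fun f g => E (fcons i f) (fcons j g))).
  by apply: eq_bigr => h _; rewrite /E !fcons0 !fcons_tail fsplitK.
under eq_bigr do under eq_bigr do rewrite sum_det_dcoord.
under eq_bigr do rewrite exchange_big /=.
rewrite exchange_big /=.
under [RHS]eq_bigr do under eq_bigr do rewrite mulr_suml.
under [RHS]eq_bigr do rewrite exchange_big /=.
rewrite [RHS]exchange_big /=; apply: eq_bigr => t _.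
(* The heads range over all indices, so t(i) and t(j) may replace them; heads and tails are then the
   images under t of the lists of T(i, j). *)
rewrite (reindex_inj (@perm_inj _ t)); apply: eq_bigr => i _ /=.
rewrite (reindex_inj (@perm_inj _ t)); apply: eq_bigr => j _ /=.
rewrite /G (inj_eq perm_inj) /front_cons /back_cons !comp_fcons.
by rewrite !mulrA.
Qed.

(** * Whitney forms in barycentric coordinates *)

Section WedgeOfOneForms.
Variables (R : realType) (n : nat).

(** In the induction step, each of the k! permutations [p] of the inner determinant is absorbed into
    the outer one, leaving a copy of the full determinant; the factor 1/(1! k!) of [fwedge] cancels
    the k! copies. *)
Lemma fwedge_all_det k (a : 'I_k -> Defs.form R n 1) x (u : 'I_k -> 'rV[R]_n) :
  fwedge_all a x u = \det (\matrix_(i, j) a i x (fun=> u j)).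
Proof.
elim: k a u => [|k IH] a u; first by rewrite det_mx00.
rewrite /= /fwedge -[1`!%N]/1%N mul1n.
pose M : 'M[R]_k.+1 := \matrix_(i, j) a i x (fun=> u j).
apply: (canLR (mulKf _)); first by rewrite pnatr_eq0 -lt0n fact_gt0.
transitivity (\sum_(p : 'S_k) \det M); last first.
  by rewrite sumr_const card_Sn mulr_natl.
under eq_bigr => s _.
  rewrite IH /determinant mulr_sumr.
  over.
rewrite exchange_big; apply: eq_bigr => p _ /=.
rewrite [\det M]/determinant [RHS](reindex_inj (mulgI (lift_perm ord0 ord0 p))) /=.
apply: eq_bigr => s _; rewrite odd_permM odd_lift_perm /= signr_addb.
rewrite big_ord_recl permM lift_perm_id mxE.
have -> : (fun i : 'I_1 => u (s (lshift k i))) = fun=> u (s ord0).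
  by apply/funext => i; rewrite ord1; congr (u (s _)); exact: val_inj.
rewrite mulrACA [(-1) ^+ s * _]mulrC; congr (_ * (_ * _)).
apply: eq_bigr => i _; rewrite !mxE permM lift_perm_lift.
by apply/congr1/funext => j; congr (u (s _)); exact: val_inj.
Qed.
End WedgeOfOneForms.

(** * Barycentric coordinates, their differentials, and W sigma on nu *)

Section LambdaDifferential.
Variables (R : realType) (V : choiceType) (X : simplicial_complex V).
Variables (n : nat) (nu : osimplex X n).

Definition dlambda (v : V) (u : 'rV[R]_n) : R :=
  \sum_(i < n.+1 | nu i == v) dcoord i u.

Lemma dlambda_is_linear v : linear (dlambda v : 'rV[R]_n -> R^o).
Proof.
move=> c u w; rewrite /dlambda scaler_sumr -big_split; apply: eq_bigr => i _ /=.
rewrite /dcoord; case: unlift => [j|]; first by rewrite !mxE.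
rewrite scalerN -opprD scaler_sumr -big_split; congr (- _).
by apply: eq_bigr => j _; rewrite !mxE.
Qed.

HB.instance Definition _ v := GRing.isLinear.Build R 'rV[R]_n R^o _ (dlambda v)
  (dlambda_is_linear v).

Lemma continuous_dlambda v : continuous (dlambda v : 'rV[R]_n -> R^o).
Proof.
apply: continuous_big => [|i _]; first exact: add_continuous.
rewrite /dcoord; case: unlift => [j|]; first exact: coord_continuous.
have cS : continuous (fun u : 'rV[R]_n => \sum_(j < n) u ord0 j : R^o).
  by apply: continuous_big => [|j _]; [exact: add_continuous|exact: coord_continuous].
by move=> x; apply: continuousN; exact: cS.
Qed.

Lemma affine_coordE (x : 'rV[R]_n) i : affine_coord x i = affine_coord 0 i + dcoord i x.
Proof.
rewrite /affine_coord /dcoord; case: unlift => [j|]; first by rewrite mxE add0r.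
by rewrite [X in 1 - X + _]big1 ?subr0// => j _; rewrite mxE.
Qed.

(** In the parametrization lambda_v is affine: its value at 0 plus the linear map [dlambda v]. *)
Lemma dform_lambda v x u : dform (lambda nu v : 'rV[R]_n -> R) x u = dlambda v (u ord0).
Proof.
have -> : lambda nu v = cst (lambda nu v (0 : 'rV[R]_n)) + dlambda v :> ('rV[R]_n -> R^o).
  apply/funext => y; rewrite /lambda /simplex_param /= -[RHS]big_split.
  by apply: eq_bigr => i _ /=; rewrite affine_coordE.
rewrite /dform diffD; first last.
- exact/linear_differentiable/continuous_dlambda.
- exact: differentiable_cst.
by rewrite /= diff_cst add0r diff_lin //; exact: continuous_dlambda.
Qed.

Lemma lambda_vertex i (x : 'rV[R]_n) : lambda nu (nu i) x = affine_coord x i.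
Proof.
have /andP[/injectiveP nu_inj _] := osimplexP nu.
rewrite /lambda /simplex_param (big_pred1 i) // => j /=; exact: inj_eq.
Qed.

Lemma dlambda_vertex i u : dlambda (nu i) u = dcoord i u.
Proof.
have /andP[/injectiveP nu_inj _] := osimplexP nu.
by rewrite /dlambda (big_pred1 i) // => j /=; exact: inj_eq.
Qed.

Lemma lambda_notin v (x : 'rV[R]_n) : v \notin codom nu -> lambda nu v x = 0.
Proof.
move=> vnu; apply: big_pred0 => i; apply: contraNF vnu => /eqP <-; exact: codom_f.
Qed.

Lemma dlambda_notin v u : v \notin codom nu -> dlambda v u = 0.
Proof.
move=> vnu; apply: big_pred0 => i; apply: contraNF vnu => /eqP <-; exact: codom_f.
Qed.

(** A tensor product rather than a wedge product: antisymmetrization is left to the sum over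
    permutations in [whitney_osimplexE]. *)
Definition lambda_dlambda k (v : 'I_k.+1 -> V) (x : 'rV[R]_n) (u : 'I_k -> 'rV[R]_n) : R :=
  lambda nu (v ord0) x * \prod_(j < k) dlambda (v (lift ord0 j)) (u j).

(** The definition of W sigma is the cofactor expansion, along column 0, of the determinant with one
    column of lambda_sigma(i) and columns dlambda_sigma(i)(u_j); the Leibniz formula for it gives
    the right-hand side. *)
Lemma whitney_osimplexE k (sigma : osimplex X k) x u :
  whitney_osimplex nu sigma x u =
  k`!%:R * \sum_(s : 'S_k.+1) (-1) ^+ s * lambda_dlambda (osimplex_perm sigma s) x u.
Proof.
rewrite /whitney_osimplex; congr (_ * _).
pose M : 'M[R]_k.+1 := \matrix_(i, j) if unlift ord0 j is Some j' then
  dlambda (sigma i) (u j') else lambda nu (sigma i) x.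
transitivity (\det M).
  rewrite (expand_det_col _ ord0); apply: eq_bigr => i _.
  rewrite fwedge_all_det /cofactor mxE unlift_none addn0 mulrA [_ * (-1) ^+ _]mulrC.
  congr (_ * \det _); apply/matrixP => a b.
  by rewrite !mxE liftK dform_lambda.
rewrite -det_tr; apply: eq_bigr => s _; rewrite big_ord_recl /lambda_dlambda.
rewrite !mxE unlift_none ffunE; congr (_ * (_ * _)); apply: eq_bigr => j _.
by rewrite !mxE liftK ffunE.
Qed.

End LambdaDifferential.

(** * Ordered simplices and their vertex sets *)

Lemma osvert_inj (V : choiceType) (X : simplicial_complex V) k (sigma : osimplex X k) :
  injective sigma.
Proof. by have /andP[/injectiveP] := osimplexP sigma. Qed.

Section VertexSets.
Variables (V : choiceType) (X : simplicial_complex V) (k : nat).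

Definition vertex_set (v : 'I_k.+1 -> V) : {fset V} := [fset v i | i : 'I_k.+1]%fset.

Lemma vertex_setP (v : 'I_k.+1 -> V) x :
  reflect (exists i, x = v i) (x \in vertex_set v).
Proof.
by apply: (iffP (imfsetP _ _ _ _)) => [[i _ ->]|[i ->]]; exists i.
Qed.

Lemma vertex_set_ksimplex (sigma : osimplex X k) :
  X (vertex_set sigma) && (#|` vertex_set sigma| == k.+1).
Proof.
have /andP[_ ->] := osimplexP sigma.
by rewrite card_imfset /= ?size_enum_ord ?eqxx //; exact: osvert_inj.
Qed.

Definition face (sigma : osimplex X k) : ksimplex X k :=
  exist _ (vertex_set sigma) (vertex_set_ksimplex sigma).

Lemma vertex_set_orient (s : ksimplex X k) : vertex_set (orient s) = val s.
Proof.
apply/fsetP => x; apply/vertex_setP/idP => [[i ->]|].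
  by rewrite ffunE (mem_tnth i).
have s_size : size (val s) == k.+1 by case: s => t /= /andP[].
move=> xs; have /tnthP[i xi] : x \in Tuple s_size by [].
by exists i; rewrite xi ffunE !(tnth_nth x).
Qed.

Lemma vertex_set_perm (sigma : osimplex X k) (p : 'S_k.+1) :
  vertex_set (osimplex_perm sigma p) = vertex_set sigma.
Proof.
apply/fsetP => x; apply/vertex_setP/vertex_setP => -[i ->].
  by exists (p i); rewrite ffunE.
by exists (p^-1%g i); rewrite ffunE permKV.
Qed.

Lemma osimplex_perm_ex (sigma tau : osimplex X k) :
  vertex_set sigma = vertex_set tau -> exists p, osimplex_perm tau p = sigma.
Proof.
move=> st.
have /(@choice _ _)[f fE] i : exists j, sigma i = tau j.
  by apply/vertex_setP; rewrite -st; apply/vertex_setP; exists i.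
have f_inj : injective f by move=> i j ij; apply: (@osvert_inj _ _ _ sigma); rewrite !fE ij.
by exists (perm f_inj); apply/val_inj/ffunP => i; rewrite ffunE permE -fE.
Qed.

Lemma osimplex_perm_inj (sigma : osimplex X k) : injective (osimplex_perm sigma).
Proof.
move=> p q /(congr1 val)/ffunP pq; apply/permP => i.
by have := pq i; rewrite !ffunE => /osvert_inj.
Qed.

(** A simplex with a permutation of its chosen ordering amounts to an ordered simplex. Only those
    with all vertices in [nu] contribute, and they are the [nu \o f] with [f] injective; for other
    [f], [insub] fails and the default 0 is taken. *)
Lemma sum_orient_perm (R : nmodType) n (nu : osimplex X n) (F : osimplex X k -> R) :
  (forall (sigma : osimplex X k) i, sigma i \notin codom nu -> F sigma = 0) ->
  \sum_(s \in [set: ksimplex X k]) \sum_(p : 'S_k.+1) F (osimplex_perm (orient s) p) =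
  \sum_(f : {ffun 'I_k.+1 -> 'I_n.+1}) oapp F 0 (insub [ffun i => nu (f i)]).
Proof.
move=> F0.
pose nuf (f : {ffun 'I_k.+1 -> 'I_n.+1}) : {ffun 'I_k.+1 -> V} := [ffun i => nu (f i)].
pose faces : seq (osimplex X k) :=
  pmap insub [seq nuf f | f <- enum {: {ffun 'I_k.+1 -> 'I_n.+1}}].
have nuf_inj : injective nuf.
  move=> f g /ffunP fg; apply/ffunP => i; apply: (@osvert_inj _ _ _ nu).
  by have := fg i; rewrite !ffunE.
have mem_faces (sigma : osimplex X k) :
    reflect (forall i, sigma i \in codom nu) (sigma \in faces).
  rewrite mem_pmap_sub; apply: (iffP mapP) => [[f _ sf] i|snu].
    by rewrite sf ffunE codom_f.
  exists [ffun i => iinv (snu i)]; first by rewrite mem_enum.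
  by apply/ffunP => i; rewrite !ffunE f_iinv.
(* The finitely many simplices that can contribute to the sum. *)
pose ss := undup (map face faces).
have faceE (sigma : osimplex X k) s : face sigma = s <-> vertex_set sigma = val s.
  by split=> [<-//|e]; exact: val_inj.
(* Each ordered face arises exactly once, from the chosen ordering of its vertex set and one
   permutation. *)
have perm_ss : perm_eq [seq osimplex_perm (orient s) p | s <- ss, p <- enum 'S_k.+1] faces.
  apply: uniq_perm.
  - apply: allpairs_uniq; [exact: undup_uniq|exact: enum_uniq|].
    move=> [s p] [s' p'] _ _ /= e.
    have ss' : s = s'.
      apply: val_inj; rewrite -!vertex_set_orient.
      by rewrite -(vertex_set_perm _ p) e vertex_set_perm.
    by move: e; rewrite ss' => /osimplex_perm_inj ->.
  - by rewrite pmap_sub_uniq // map_inj_uniq ?enum_uniq.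
  - move=> sigma; apply/allpairsP/mem_faces => [[[s p] /= [sss _ ->]] i|/mem_faces sf].
      move: sss; rewrite mem_undup => /mapP[tau /mem_faces tauf ss_eq].
      have : osimplex_perm (orient s) p i \in vertex_set tau.
        have -> : vertex_set tau = vertex_set (osimplex_perm (orient s) p).
          by rewrite vertex_set_perm vertex_set_orient ss_eq.
        by apply/vertex_setP; exists i.
      by case/vertex_setP => j ->.
    have [p ps] := @osimplex_perm_ex sigma (orient (face sigma))
      (esym (vertex_set_orient (face sigma))).
    exists (face sigma, p); rewrite /= mem_undup map_f // mem_enum; split=> //.
rewrite (fsbigE ss) ?undup_uniq //; last first.
  move=> s _ sss; apply: big1 => p _.
  suff [i ni] : exists i, osimplex_perm (orient s) p i \notin codom nu by exact: F0 ni.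
  apply: contrapT => /forallNP nofaces; case/negP: sss; rewrite mem_undup.
  apply/mapP; exists (osimplex_perm (orient s) p).
    by apply/mem_faces => i; have /negP := nofaces i; rewrite negbK.
  by apply/esym/faceE; rewrite vertex_set_perm vertex_set_orient.
rewrite (eq_bigl predT); last by move=> s; rewrite in_setT.
transitivity (\sum_(sigma <- faces) F sigma).
  by rewrite -(perm_big _ perm_ss) big_allpairs_dep /=;
    apply: eq_bigr => s _; rewrite big_enum.
by rewrite /faces big_pmap big_map big_enum.
Qed.
End VertexSets.

(** * Extension of cochains by zero *)

Section CochainExtension.
Variables (R : realType) (V : choiceType) (X : simplicial_complex V) (k : nat).
Variable alpha : cochain R X k.

(** The default 0 covers tuples with a repeated vertex and tuples that span no simplex of [X]. *)
Definition cochain_ext (v : 'I_k.+1 -> V) : R :=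
  oapp (fun sigma : osimplex X k => alpha (oriented R sigma)) 0 (insub (finfun v)).

Lemma cochain_ext_osimplex (sigma : osimplex X k) (v : 'I_k.+1 -> V) :
  sigma =1 v -> cochain_ext v = alpha (oriented R sigma).
Proof.
move=> sv; rewrite /cochain_ext.
have -> : finfun v = val sigma by apply/ffunP => i; rewrite ffunE -sv.
by rewrite valK.
Qed.

Lemma alternating_cochain_ext : alternating cochain_ext.
Proof.
move=> v s; have [vX|vX] := boolP (is_osimplex X (finfun v)).
  have e1 : OSimplex vX =1 v by move=> i; rewrite /= ffunE.
  have e2 : osimplex_perm (OSimplex vX) s =1 v \o s by move=> i; rewrite !ffunE.
  by rewrite (cochain_ext_osimplex e1) (cochain_ext_osimplex e2) eval_perm.
(* The tuple [v \o s] is no ordered simplex either, since undoing [s] would make [v] one. *)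
rewrite /cochain_ext (insubN _ vX) /= mulr0 insubN //; apply: contra vX => vsX.
have := is_osimplex_comp (OSimplex vsX) (@perm_inj _ s^-1%g).
congr (is_osimplex X _).
by apply/ffunP => i; rewrite !ffunE /= ?ffunE /= permKV.
Qed.
End CochainExtension.

(** * Whitney forms of cochains and their wedge product *)

Section WhitneyOnSimplex.
Variables (R : realType) (V : choiceType) (X : simplicial_complex V).
Variables (n : nat) (nu : osimplex X n).

Lemma alternating_comp_cochain_ext k (alpha : cochain R X k) :
  alternating (fun f : 'I_k.+1 -> 'I_n.+1 => cochain_ext alpha (nu \o f)).
Proof. by move=> f s; rewrite -alternating_cochain_ext. Qed.

Lemma whitneyE k (alpha : cochain R X k) x u :
  whitney nu alpha x u = k`!%:R * \sum_(f : {ffun 'I_k.+1 -> 'I_n.+1})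
    cochain_ext alpha (nu \o f) *
    (affine_coord x (f ord0) * \prod_(j < k) dcoord (f (lift ord0 j)) (u j)).
Proof.
pose F (sigma : osimplex X k) : R :=
  k`!%:R * (alpha (oriented R sigma) * lambda_dlambda nu sigma x u).
transitivity (\sum_(s \in [set: ksimplex X k]) \sum_(p : 'S_k.+1)
    F (osimplex_perm (orient s) p)).
  (* The sign of [p] is absorbed by [alpha], evaluated on the permuted simplex; the arbitrary
     orientations thereby disappear. *)
  apply: eq_fsbigr => s _; rewrite whitney_osimplexE mulrCA mulr_sumr mulr_sumr.
  by apply: eq_bigr => p _; rewrite /F eval_perm; congr (_ * _); rewrite mulrCA mulrA.
rewrite (@sum_orient_perm _ _ _ _ _ nu) => [|sigma i ni]; last first.
  rewrite /F /lambda_dlambda; move: ni; case: (unliftP ord0 i) => [j|] -> ni.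
    by rewrite (bigD1 j) //= dlambda_notin // mul0r !mulr0.
  by rewrite lambda_notin // mul0r !mulr0.
rewrite mulr_sumr; apply: eq_bigr => f _; rewrite /cochain_ext.
have -> : finfun (nu \o f) = [ffun i => nu (f i)] by apply/ffunP => i; rewrite !ffunE.
case: insubP => /= [sigma _ sf|_]; last by rewrite mul0r mulr0.
have {}sf i : sigma i = nu (f i) by rewrite sf ffunE.
rewrite /F /lambda_dlambda sf lambda_vertex; congr (_ * (_ * (_ * _))).
by apply: eq_bigr => j _; rewrite sf dlambda_vertex.
Qed.
End WhitneyOnSimplex.

(** The factors k! and l! of the Whitney forms cancel the normalization of [fwedge]. For each
    permutation, the two products of differentials form one Leibniz term of the determinant whose
    rows are the tails of [f] and [g]. *)
Lemma fwedge_whitneyE (R : realType) (V : choiceType) (X : simplicial_complex V)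
    (k l : nat) (alpha : cochain R X k) (beta : cochain R X l)
    (nu : osimplex X (k + l)) x :
  fwedge (whitney nu alpha) (whitney nu beta) x (fun i => delta_mx ord0 i) =
  \sum_(f : {ffun 'I_k.+1 -> 'I_(k + l).+1}) \sum_(g : {ffun 'I_l.+1 -> 'I_(k + l).+1})
    cochain_ext alpha (nu \o f) * cochain_ext beta (nu \o g) *
    \det (\matrix_(i, j) dcoord
      (@fsplit _ k l (f \o lift ord0) (g \o lift ord0) i) (delta_mx ord0 j)) *
    (affine_coord x (f ord0) * affine_coord x (g ord0)).
Proof.
rewrite /fwedge; apply: (canLR (mulKf _)).
  by rewrite pnatr_eq0 -lt0n muln_gt0 !fact_gt0.
rewrite mulr_sumr.
under [RHS]eq_bigr => f _.
  rewrite mulr_sumr.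
  under eq_bigr => g _ do rewrite /determinant mulr_sumr mulr_suml mulr_sumr.
  rewrite exchange_big /=.
  over.
rewrite [RHS]exchange_big /=; apply: eq_bigr => s _.
rewrite !whitneyE -mulrA mulrACA -natrM big_distrlr /= !mulr_sumr.
apply: eq_bigr => f _; rewrite !mulr_sumr; apply: eq_bigr => g _.
rewrite big_split_ord /=.
under [X in _ = _ * (_ * (_ * (X * _)) * _)]eq_bigr => i _ do
  rewrite mxE /fsplit (fintype.unsplitK (inl i)) /=.
under [X in _ = _ * (_ * (_ * (_ * X)) * _)]eq_bigr => i _ do
  rewrite mxE /fsplit (fintype.unsplitK (inr i)) /=.
move: (cochain_ext alpha _) (cochain_ext beta _) (affine_coord x (f _))
  (affine_coord x (g _)) (\prod_(j < k) _) (\prod_(j < l) _) ((-1) ^+ s : R) _%:R.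
by move=> *; ring.
Qed.

Theorem proposition2p5 (R : realType) (V : choiceType)
    (X : simplicial_complex V) (hX : triangulated_manifold R X)
    (k l : nat) (alpha : cochain R X k) (beta : cochain R X l)
    (nu : osimplex X (k + l)) :
  (wedge alpha beta (oriented R nu))%:E =
  integral_simplex (fwedge (whitney nu alpha) (whitney nu beta)).
Proof.
pose A f := cochain_ext alpha (nu \o f).
pose B f := cochain_ext beta (nu \o f).
(* The front and back faces of a reordering t of [nu] are [nu \o t] on the indices 0..k and
   k..k+l. *)
have wedgeE : wedge alpha beta (oriented R nu) =
    ((k + l).+1)`!%:R^-1 * altsum A B (@front_index k l) (@back_index k l).
  rewrite /= freeg.liftU scale1r; congr (_ * _); apply: eq_bigr => t _.
  congr (_ * (_ * _)); symmetry; apply: cochain_ext_osimplex => i;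
    by rewrite !ffunE.
pose K (f : {ffun 'I_k.+1 -> 'I_(k + l).+1}) (g : {ffun 'I_l.+1 -> 'I_(k + l).+1}) : R :=
  A f * B g * \det (\matrix_(i, j) dcoord
      (@fsplit _ k l (f \o lift ord0) (g \o lift ord0) i) (delta_mx ord0 j)).
(* The coefficient of lambda_i lambda_j in the wedge product of the Whitney forms, evaluated on the
   standard basis. *)
pose C i j := \sum_(f : {ffun 'I_k.+1 -> 'I_(k + l).+1} | f ord0 == i)
  \sum_(g : {ffun 'I_l.+1 -> 'I_(k + l).+1} | g ord0 == j) K f g.
(* The weight [w] stands both for the integrals of lambda_i lambda_j and for their values at a
   point. *)
have sumC (w : 'I_(k + l).+1 -> 'I_(k + l).+1 -> R) :
    \sum_(f : {ffun 'I_k.+1 -> 'I_(k + l).+1}) \sum_(g : {ffun 'I_l.+1 -> 'I_(k + l).+1})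
      K f g * w (f ord0) (g ord0) = \sum_i \sum_j C i j * w i j.
  rewrite (partition_big (fun f : {ffun 'I_k.+1 -> 'I_(k + l).+1} => f ord0) predT) //=.
  apply: eq_bigr => i _; rewrite exchange_big /=.
  rewrite (partition_big (fun g : {ffun 'I_l.+1 -> 'I_(k + l).+1} => g ord0) predT) //=.
  apply: eq_bigr => j _; rewrite exchange_big mulr_suml /=.
  apply: eq_bigr => f /eqP <-; rewrite mulr_suml.
  by apply: eq_bigr => g /eqP <-.
transitivity (\int[tuple_lebesgue R (k + l)]_(t in @std_simplex R (k + l))
    (\sum_i \sum_j C i j *
      (affine_coord (\row_a tnth t a) i * affine_coord (\row_a tnth t a) j))%:E)%E.
  rewrite integral_affine_coord_quadratic -sumC wedgeE; congr EFin.
  under eq_bigr do under eq_bigr do rewrite mulrA.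
  under eq_bigr do rewrite -mulr_suml.
  (* With n = k + l, split (n+2)! as (n+2) (n+1)!: the factor n+2 cancels the one from
     [wedge_coefficient_sum], and 1/(n+1)! is the normalization of the discrete wedge product. *)
  rewrite -mulr_suml (factS (k + l).+1) (natrM _ (k + l).+2) invfM.
  transitivity ((k + l).+2%:R * altsum A B (@front_index k l) (@back_index k l) *
      ((k + l).+2%:R^-1 / (k + l).+1`!%:R)).
    by rewrite mulrACA mulfV ?pnatr_eq0// mul1r mulrC.
  congr (_ * _); rewrite -wedge_coefficient_sum; try exact: alternating_comp_cochain_ext.
  by apply: eq_bigr => f _; apply: eq_bigr => g _; rewrite mulrAC.
apply: eq_integral => t _; congr EFin.
by rewrite fwedge_whitneyE -(sumC (fun i j => affine_coord (\row_a tnth t a) i *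
  affine_coord (\row_a tnth t a) j)).
Qed.
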